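(* For all ordinals $\alpha,\beta<\omega_1$ with $\alpha>0$ there exist a filter $\mathcal{F}$ of rank $\beta$ on a countable set $I$ and a family $(\mathcal{F}_i)_{i\in I}$ of filters on a countable set $X$, each of rank $\alpha$, such that $\lim_{\mathcal{F}}\mathcal{F}_i$ has rank $1$.
   Context: Filters on a countable set are viewed as subsets of the Cantor space of its power set. For $\mathcal{A}\subset\mathcal{P}(I)$ let $\mathcal{A}^*=\{A\subset I:I\setminus A\in\mathcal{A}\}$. The rank of an analytic filter is ${\rm rk}(\mathcal{F})=\min\{\alpha<\omega_1:$ there is a $\Sigma^0_{1+\alpha}$ set $S$ with $\mathcal{F}\subset S$ and $S\cap\mathcal{F}^*=\emptyset\}$. For a filter $\mathcal{F}$ on $I$ and filters $\mathcal{F}_i$ on $X$, $\lim_{\mathcal{F}}\mathcal{F}_i=\{A\subset X:\{i\in I:A\in\mathcal{F}_i\}\in\mathcal{F}\}$. *)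

(* Defs.v *)
From HB Require Import structures.
From mathcomp Require Import all_boot all_order.
From mathcomp Require Import all_classical wochoice topology.

Set Implicit Arguments.
Unset Strict Implicit.
Unset Printing Implicit Defensive.

Import Order.TTheory.

Local Open Scope classical_set_scope.
Local Open Scope order_scope.

(* The ordinal omega_1 (whose elements are the countable ordinals): well-order
   the uncountable type [set nat] and keep the points having only countably
   many predecessors.  Well-foundedness, countability of the initial segments
   and uncountability, which characterize omega_1 up to a unique isomorphism,
   are [omega1_min], [omega1_countable_le] and [omega1_uncountable]. *)

Definition wole : rel (set nat) := sval (well_ordering_principle (set nat)).

Lemma wole_min (A : set (set nat)) :
  A !=set0 -> exists2 z, A z & forall x, A x -> wole z x.
Proof.
move=> [x Ax]; have /(_ (mem A)) := svalP (well_ordering_principle (set nat)).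
case=> [|z [[Az lbA] _]]; first by exists x; rewrite inE.
by exists z => [|y Ay]; [rewrite inE in Az | apply: lbA; rewrite inE].
Qed.

Lemma wole_total : total wole.
Proof.
move=> x y; have [|z [->|->] lb] := @wole_min [set x; y].
- by exists x; left.
- by rewrite lb //; right.
- by rewrite lb ?orbT //; left.
Qed.

Lemma wole_anti : antisymmetric wole.
Proof.
move=> x y /andP[xy yx].
have /(_ (mem [set x; y])) := svalP (well_ordering_principle (set nat)).
case=> [|z [_ zU]]; first by exists x; rewrite inE; left.
have xx : wole x x by have := wole_total x x; rewrite orbb.
have yy : wole y y by have := wole_total y y; rewrite orbb.
by rewrite -(zU x) ?(zU y) //; split; rewrite ?inE /=;
  [right| |left|] => // t; rewrite inE => -[|] ->.
Qed.

Lemma wole_trans : transitive wole.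
Proof.
move=> y x z xy yz.
have [|t tA lb] := @wole_min [set t | [\/ t = x, t = y | t = z]].
  by exists x; constructor 1.
case: tA lb => -> lb.
- by apply: lb; constructor 3.
- have yx : wole y x by apply: lb; constructor 1.
  by rewrite (@wole_anti x y) ?xy.
- have zy : wole z y by apply: lb; constructor 2.
  by rewrite (@wole_anti z y) ?zy.
Qed.

Definition omega1 : Type :=
  {x : set nat | `[< countable [set y | wole y x] >]}.

HB.instance Definition _ := SubChoice.on omega1.

Fact omega1_display : Order.disp_t. Proof. exact: Order.default_display. Qed.

Definition omega1_le (a b : omega1) := wole (val a) (val b).

Lemma omega1_le_refl : reflexive omega1_le.
Proof. by move=> a; have := wole_total (val a) (val a); rewrite orbb. Qed.

Lemma omega1_le_anti : antisymmetric omega1_le.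
Proof. by move=> a b /wole_anti/val_inj. Qed.

Lemma omega1_le_trans : transitive omega1_le.
Proof. by move=> b a c; exact: wole_trans. Qed.

Lemma omega1_le_total : total omega1_le.
Proof. by move=> a b; exact: wole_total. Qed.

HB.instance Definition _ := Order.Le_isPOrder.Build omega1_display omega1
  omega1_le_refl omega1_le_anti omega1_le_trans.

HB.instance Definition _ := Order.POrder_isTotal.Build omega1_display omega1
  omega1_le_total.

Lemma omega1_min (A : set omega1) :
  A !=set0 -> exists2 a, A a & forall b, A b -> a <= b.
Proof.
move=> [a0 Aa0].
have [|_ [a Aa <-] lb] := @wole_min [set val a | a in A].
  by exists (val a0), a0.
by exists a => // b Ab; apply: lb; exists b.
Qed.

Lemma omega1_countable_le (a : omega1) : countable [set b | b <= a].
Proof.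
have /asboolP/countable_injP[f finj] := valP a.
apply/countable_injP; exists (f \o val) => x y; rewrite !inE => xa ya fxy.
by apply/val_inj/finj; rewrite ?inE.
Qed.

Lemma set_nat_uncountable : ~ countable [set: set nat].
Proof.
move=> /countable_injP[f finj].
pose D : set nat := [set n | exists2 A, f A = n & ~ A n].
have DfD : ~ D (f D).
  move=> [A fA nA]; have AD : A = D by apply: finj; rewrite ?inE.
  by apply: (nA); rewrite {1}AD; exists A.
by apply: (DfD); exists D.
Qed.

Lemma omega1_uncountable : ~ countable [set: omega1].
Proof.
move=> cW; pose C := [set x | countable [set y | wole y x]].
have cC : countable C.
  apply: (@sub_countable _ _ _ (val @` [set: omega1])).
    apply: subset_card_le => x Cx.
    by exists (exist _ x (asboolT Cx) : omega1).
  exact: sub_countable (card_image_le _ _) cW.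
have [CT|nCT] := pselect (C = setT).
  by apply: set_nat_uncountable; rewrite -CT.
have [|x nCx lb] := @wole_min (~` C).
  by apply/set0P/eqP; rewrite -setCT => /(can_inj (@setCK _)).
apply: nCx; case/countable_injP: cC => f finj.
have memC y : wole y x -> y != x -> y \in C.
  move=> yx /eqP nyx; rewrite inE; apply: contrapT => /lb xy.
  by apply: nyx; apply: wole_anti; rewrite yx.
apply/countable_injP; exists (fun y => if y == x then 0%N else (f y).+1).
move=> y z; rewrite !inE /= => yx zx; case: eqVneq => [->|ny]; case: eqVneq => // nz.
by case; apply: finj; exact: memC.
Qed.

Lemma omega1_inhabited : exists a : omega1, forall b, a <= b.
Proof.
have [|a _ lb] := @omega1_min setT; last by exists a => b; exact: lb.
by apply/set0P/negP => /eqP W0; apply: omega1_uncountable; rewrite W0.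
Qed.

Definition omega1_bot : omega1 := sval (cid omega1_inhabited).

Lemma omega1_bot_le a : omega1_bot <= a.
Proof. exact: svalP (cid omega1_inhabited) a. Qed.

HB.instance Definition _ :=
  Order.hasBottom.Build omega1_display omega1 omega1_bot_le.

Lemma omega1_has_succ (a : omega1) :
  exists b : omega1, a < b /\ forall c, a < c -> b <= c.
Proof.
have [|b ab lb] := @omega1_min [set b | a < b]; last by exists b.
apply/set0P/negP => /eqP aT; apply: omega1_uncountable.
suff <- : [set b | b <= a] = setT by exact: omega1_countable_le.
apply/seteqP; split=> // b _ /=; rewrite leNgt; apply/negP => ab.
by have : [set b | a < b] b by []; rewrite aT.
Qed.

Definition osucc (a : omega1) : omega1 := sval (cid (omega1_has_succ a)).

Lemma osucc_gt a : a < osucc a.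
Proof. by case: (svalP (cid (omega1_has_succ a))). Qed.

Lemma osucc_le a b : a < b -> osucc a <= b.
Proof. by case: (svalP (cid (omega1_has_succ a))) => _; exact. Qed.

Definition ord_zero : omega1 := \bot.
Definition ord_one : omega1 := osucc ord_zero.

(* [Sigma0_1plus a] is the additive Borel class Sigma^0_{1+a}.  The map
   g |-> 1+g is an isomorphism from {g | g < a} onto {x | 1 <= x < 1+a}, so
   the usual recursion
     Sigma^0_x = {\bigcup_n A_n | A_n \in Pi^0_{x_n}, 1 <= x_n < x}
   reads, for x = 1+a, as in the second constructor. *)
Inductive Sigma0_1plus (T : topologicalType) : omega1 -> set T -> Prop :=
| Sigma0_open (U : set T) : open U -> Sigma0_1plus ord_zero U
| Sigma0_bigcup (a : omega1) (g : nat -> omega1) (A : nat -> set T) :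
    ord_zero < a ->
    (forall n, g n < a) ->
    (forall n, Sigma0_1plus (g n) (~` A n)) ->
    Sigma0_1plus a (\bigcup_n A n).

Lemma Sigma0_zeroE (T : topologicalType) (U : set T) :
  Sigma0_1plus ord_zero U <-> open U.
Proof.
split; last exact: Sigma0_open.
have gen a (V : set T) : Sigma0_1plus a V -> a = ord_zero -> open V.
  by case=> // b g A b0 _ _ E; rewrite E ltxx in b0.
by move=> s; exact: gen s erefl.
Qed.

Lemma Sigma0_oneE (T : topologicalType) (U : set T) :
  Sigma0_1plus ord_one U <->
  exists2 A : nat -> set T, (forall n, closed (A n)) & U = \bigcup_n A n.
Proof.
split=> [|[A cA ->]]; last first.
  apply: (@Sigma0_bigcup _ _ (fun=> ord_zero)) => [|n|n]; try exact: osucc_gt.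
  by apply/Sigma0_open; rewrite openC.
have gen a (V : set T) : Sigma0_1plus a V -> a = ord_one ->
    exists2 A : nat -> set T, (forall n, closed (A n)) & V = \bigcup_n A n.
  case=> [W _ E|b g A b0 gb sA E].
    by have := osucc_gt ord_zero; rewrite -/ord_one -E ltxx.
  exists A => // n; rewrite -openC; apply/Sigma0_zeroE.
  suff <- : g n = ord_zero by exact: sA.
  apply/eqP; rewrite eq_le omega1_bot_le andbT leNgt; apply/negP => /osucc_le.
  by rewrite leNgt -/ord_one -E gb.
by move=> s; exact: gen s erefl.
Qed.

(* The power set of [I] as the topological space {0,1}^I; the carrier is
   convertible to [set I], so that a [set_system I] is a subset of it. *)
Definition powerset_space (I : Type) : Type :=
  prod_topology (fun _ : I => discrete_topology Prop).

HB.instance Definition _ (I : Type) := Topological.on (powerset_space I).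

Definition baire_space : Type := prod_topology (fun _ : nat => nat).

HB.instance Definition _ := Topological.on baire_space.

Definition analytic (T : topologicalType) (A : set T) : Prop :=
  A = set0 \/ exists2 f : baire_space -> T, continuous f & A = range f.

Definition dual_system (I : Type) (A : set_system I) : set_system I :=
  [set B | A (~` B)].

Definition Sigma0_separated (I : Type) (F : set_system I) (a : omega1) : Prop :=
  exists S : set (powerset_space I),
    [/\ Sigma0_1plus a S, F `<=` S & S `&` dual_system F = set0].

Definition analytic_filter (I : Type) (F : set_system I) : Prop :=
  ProperFilter F /\ analytic (F : set (powerset_space I)).

Definition has_rank (I : Type) (F : set_system I) (a : omega1) : Prop :=
  [/\ analytic_filter F,
      Sigma0_separated F a &
      forall b, Sigma0_separated F b -> a <= b].

Definition filter_lim (I X : Type) (F : set_system I)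
    (G : I -> set_system X) : set_system X :=
  [set A | F [set i | G i A]].

(* Main.v *)
Require Import Defs.
From mathcomp Require Import all_boot all_order.
From mathcomp Require Import all_classical topology.

Set Implicit Arguments.
Unset Strict Implicit.
Unset Printing Implicit Defensive.

Import Order.TTheory.

Local Open Scope order_scope.
Local Open Scope classical_set_scope.

(* Collapse.  If H is a filter of rank alpha > 0 on nat, the filters G1 and G2
   generated by the cylinders C x nat and nat x C with C in H both have rank
   alpha, while a member of G1 `&` G2 contains a full line {x} x nat and a
   member of its dual does not: "some line is contained in A" is a Sigma^0_2
   condition, so G1 `&` G2 has rank at most 1; it has rank 1 because it contains
   the cofinite sets.  With F of rank beta on nat, pulled back to bool x nat,
   the limit of the family (b, n) |-> G_b is G1 `&` G2.

   Filters of every rank.  A filter has rank at least a as soon as all sets of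
   class Sigma^0_{1+b}, b < a, reduce continuously to (H, H^star), since
   Sigma^0_{1+b} is not closed under complements.  Filters with this property
   and a Sigma^0_{1+a} separator are built by induction on a, together with
   projections onto the earlier ones: at successors take the product with the
   Frechet filter, at limits the union of the pullbacks of a chain of filters
   with cofinal ranks (the Frechet limit would have rank a + 1). *)

(** * Continuity, clopen sets and cylinders in power set spaces *)

Lemma continuous_prod (T : topologicalType) (I : Type) (K : I -> topologicalType)
    (f : T -> prod_topology K) :
  (forall i, continuous (fun t => f t i)) -> continuous f.
Proof.
move=> cf t; apply/cvg_sup => i U [_ [[C oC <-] Cft sCU]].
apply: filterS sCU _; apply: (cf i t); exact: open_nbhs_nbhs.
Qed.

Lemma continuous_powerset (T : topologicalType) (I : Type)
    (f : T -> powerset_space I) :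
  (forall i, clopen [set t | f t i]) -> continuous f.
Proof.
move=> cf; apply: continuous_prod => i; apply/continuousP => A _.
(* The only points of [Prop] are [True] and [False], so the preimage of [A] is determined by which
   of the two lie in [A]. *)
pose V (b : Prop) : set T := if `[< A b >] then setT else set0.
have oV b : open (V b) by rewrite /V; case: ifP => _; [exact: openT|exact: open0].
have -> : (fun t => f t i) @^-1` A =
    ([set t | f t i] `&` V True) `|` (~` [set t | f t i] `&` V False).
  apply/seteqP; split=> t /=; rewrite /V.
    have [fti|nfti] := pselect (f t i).
      by have -> : f t i = True by [apply/propext]; move=> /asboolP ->; left; split.
    by have -> : f t i = False by [apply/propext]; move=> /asboolP ->; right; split.
  case=> -[fti]; case: asboolP => // Ab _.
    by have -> : f t i = True by apply/propext.
  by have -> : f t i = False by apply/propext.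
have [oi ci] := cf i.
by apply: openU; apply: openI => //; rewrite openC.
Qed.

Lemma clopen_coord (I : choiceType) (i : I) :
  clopen [set A : powerset_space I | A i].
Proof.
apply: (@preimage_clopen (prod_topology (fun _ : I => discrete_topology Prop))
  (discrete_topology Prop) (fun A => A i) [set P | P]).
  by split; [exact: discrete_open|exact: discrete_closed].
exact: (@proj_continuous I (fun=> discrete_topology Prop) i).
Qed.

Lemma clopen_baire_coord (k n : nat) : clopen [set z : baire_space | z k = n].
Proof.
apply: (@preimage_clopen (prod_topology (fun _ : nat => nat)) nat
  (fun z => z k) [set n]).
  by split; [exact: discrete_open|exact: discrete_closed].
exact: (@proj_continuous nat (fun=> nat) k).
Qed.

Lemma continuous_coord (T : topologicalType) (I : choiceType)
    (f : T -> powerset_space I) i :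
  continuous f -> clopen [set t | f t i].
Proof.
move=> cf; apply: (@preimage_clopen _ _ f [set A : powerset_space I | A i]) => //.
exact: clopen_coord.
Qed.

(** Openness suffices, since complementing every [Q n] yields a set of the same form. It serves
    parametrizations in which one coordinate of the parameter selects the condition on the
    others. *)
Lemma clopen_cases (T : topologicalType) (h : T -> nat) (Q : nat -> set T) :
  (forall n, clopen [set t | h t = n]) -> (forall n, clopen (Q n)) ->
  clopen [set t | Q (h t) t].
Proof.
move=> ch cQ.
have E (R : nat -> set T) : [set t | R (h t) t] =
    \bigcup_n ([set t | h t = n] `&` R n).
  by apply/seteqP; split=> t /= => [Rt|[n _ [<-]] //]; exists (h t).
have op (R : nat -> set T) : (forall n, open (R n)) -> open [set t | R (h t) t].
  move=> oR; rewrite E; apply: bigcup_open => n _; apply: openI => //.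
  by case: (ch n).
split; first by apply: op => n; case: (cQ n).
rewrite -openC; apply: (op (fun n => ~` Q n)) => n; rewrite openC.
by case: (cQ n).
Qed.

Lemma clopen_cst (T : topologicalType) (P : Prop) : clopen [set _ : T | P].
Proof.
have [p|p] := pselect P.
  rewrite (_ : [set _ | _] = setT); first exact: clopenT.
  by apply/seteqP; split.
rewrite (_ : [set _ | _] = set0); first exact: clopen0.
by apply/seteqP; split.
Qed.

(* [clopenC] has a spurious set argument. *)
Lemma clopenN (T : topologicalType) (A : set T) : clopen A -> clopen (~` A).
Proof. exact: (@clopenC _ A A). Qed.

(** Finite positive and negative information is coded by lists, so that a countable [I] has only
    countably many cylinders. *)
Definition cylinder (I : eqType) (c : seq I * seq I) : set (powerset_space I) :=
  [set A | (forall i, i \in c.1 -> A i) /\ forall i, i \in c.2 -> ~ A i].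

Lemma clopen_cylinder (I : choiceType) (c : seq I * seq I) : clopen (cylinder c).
Proof.
have fin (Q : I -> set (powerset_space I)) (s : seq I) :
    (forall i, clopen (Q i)) -> clopen [set A | forall i, i \in s -> Q i A].
  move=> cQ; elim: s => [|j s IH].
    rewrite (_ : [set _ | _] = setT); first exact: clopenT.
    by apply/seteqP; split.
  rewrite (_ : [set _ | _] = Q j `&` [set A | forall i, i \in s -> Q i A]).
    exact: clopenI.
  apply/seteqP; split=> A /= => [H|[Qj H] i].
    by split=> [|i si]; apply: H; rewrite inE ?eqxx ?si ?orbT.
  by rewrite inE => /orP[/eqP->|/H].
apply: clopenI; apply: fin => i; first exact: clopen_coord.
by apply: clopenN; exact: clopen_coord.
Qed.

Lemma open_cylinder (I : choiceType) (U : set (powerset_space I)) A :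
  open U -> U A -> exists2 c, cylinder c A & cylinder c `<=` U.
Proof.
move=> oU UA.
pose cA (s : seq I) := ([seq i <- s | `[< A i >]], [seq i <- s | ~~ `[< A i >]]).
have cAA s : cylinder (cA s) A.
  by split=> i; rewrite mem_filter => /andP[/asboolP].
(* The cylinders around [A] generate a filter; its convergence to [A], which is checked one
   coordinate at a time, puts [U] in it. *)
pose F : set_system (powerset_space I) :=
  [set V | exists s, cylinder (cA s) `<=` V].
have cAS s t : cylinder (cA (s ++ t)) `<=` cylinder (cA s) `&` cylinder (cA t).
  move=> B [B1 B2]; split; split=> i; rewrite mem_filter => /andP[Ai si];
    (apply: B1 || apply: B2); by rewrite mem_filter Ai mem_cat si ?orbT.
have FF : Filter F.
  split; first by exists [::].
    move=> V W [s sV] [t tW]; exists (s ++ t) => B /cAS[Bs Bt].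
    by split; [exact: sV|exact: tW].
  by move=> V W VW [s sV]; exists s; exact: subset_trans VW.
suff FA : F --> (A : powerset_space I).
  have [s sU] : F U by apply: FA; exact: open_nbhs_nbhs.
  by exists (cA s).
apply/cvg_sup => i V [_ [[C _ <-] CA sV]].
apply: filterS sV _; exists [:: i] => B [B1 B2] /=.
suff -> : B i = A i by [].
apply/propext; have [Ai|nAi] := pselect (A i).
  by split=> // _; apply: B1; rewrite mem_filter mem_head andbT; apply/asboolP.
split=> // Bi; case: (B2 i) => //.
by rewrite mem_filter mem_head andbT; apply/negP => /asboolP.
Qed.

(** The inclusion in [U] is a constant condition inside each term, so all terms are clopen although
    the union runs over all codes. *)
Lemma open_bigcup_cylinder (I : countType) (U : set (powerset_space I)) :
  open U -> U = \bigcup_n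
    (if unpickle n is Some c then [set A | cylinder c A /\ cylinder c `<=` U]
     else set0).
Proof.
move=> oU; apply/seteqP; split=> [A UA|A [n _]].
  have [c cA cU] := open_cylinder oU UA.
  by exists (pickle c) => //; rewrite pickleK.
by case: unpickle => // c [cA]; apply.
Qed.

(** * Countable ordinals and closure properties of the Borel classes *)

Lemma omega1_ind (Q : omega1 -> Prop) :
  (forall a, (forall b, b < a -> Q b) -> Q a) -> forall a, Q a.
Proof.
move=> IH a; apply: contrapT => nQa.
have [|b nQb lb] := @omega1_min (~` Q); first by exists a.
apply: nQb; apply: IH => c cb; apply: contrapT => /lb.
by rewrite leNgt cb.
Qed.

Lemma omega1_enum_lt (a : omega1) : ord_zero < a ->
  exists2 e : nat -> omega1, forall m, e m < a & forall b, b < a -> exists m, e m = b.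
Proof.
move=> a0; have /countable_injP[f finj] := omega1_countable_le a.
have ex m : exists b, b < a /\ forall c, c < a -> f c = m -> b = c.
  have [[b [ba fb]]|nb] := pselect (exists b, b < a /\ f b = m).
    exists b; split=> // c ca fc; apply: finj; rewrite ?inE /= ?ltW //.
    by rewrite fb.
  (* Numbers that code no ordinal below [a] receive [ord_zero], which is below [a] by hypothesis. *)
  by exists ord_zero; split=> // c ca fc; case: nb; exists c.
have [e eP] := choice ex.
exists e => [m|b ba]; first by case: (eP m).
by exists (f b); have [_ h] := eP (f b); apply: h.
Qed.

Lemma ord_zero_eq (a : omega1) : ~ (ord_zero < a) -> a = ord_zero.
Proof.
move/negP; rewrite -leNgt => a0; apply/eqP.
by rewrite eq_le a0; exact: omega1_bot_le.
Qed.

Lemma Sigma0_posE (T : topologicalType) (a : omega1) (S : set T) :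
  ord_zero < a -> Sigma0_1plus a S ->
  exists g : nat -> omega1, exists A : nat -> set T,
    [/\ forall n, g n < a, forall n, Sigma0_1plus (g n) (~` A n) &
        S = \bigcup_n A n].
Proof.
move=> a0 s; case: s a0 => [U _|b g A _ gb sA _]; first by rewrite ltxx.
by exists g, A.
Qed.

Lemma Sigma0_setT (T : topologicalType) (a : omega1) :
  Sigma0_1plus a [set: T].
Proof.
have [a0|/ord_zero_eq->] := pselect (ord_zero < a); last first.
  by apply: Sigma0_open; exact: openT.
rewrite (_ : setT = \bigcup_(n : nat) setT).
  apply: (@Sigma0_bigcup _ _ (fun=> ord_zero)) => // n.
  by rewrite setCT; apply: Sigma0_open; exact: open0.
by apply/seteqP; split=> // t _; exists 0%N.
Qed.

Lemma Sigma0_bigcup_count (K : countType) (T : topologicalType) (a : omega1)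
    (g : K -> omega1) (A : K -> set T) :
  ord_zero < a -> (forall k, g k < a) ->
  (forall k, Sigma0_1plus (g k) (~` A k)) -> Sigma0_1plus a (\bigcup_k A k).
Proof.
move=> a0 ga sA.
rewrite (_ : \bigcup_k A k =
  \bigcup_n (if unpickle n is Some k then A k else set0)).
  apply: (@Sigma0_bigcup _ _
    (fun n => if unpickle n is Some k then g k else ord_zero)) => // n.
    by case: unpickle.
  case: unpickle => // ; rewrite setC0; exact: Sigma0_setT.
apply/seteqP; split=> t [].
  by move=> k _ Ak; exists (pickle k) => //; rewrite pickleK.
by move=> n _; case: unpickle => // k Ak; exists k.
Qed.

Lemma Sigma0_bigcupS (K : countType) (T : topologicalType) (a : omega1)
    (S : K -> set T) :
  (forall k, Sigma0_1plus a (S k)) -> Sigma0_1plus a (\bigcup_k S k).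
Proof.
move=> sS; have [a0|/ord_zero_eq a0] := pselect (ord_zero < a); last first.
  rewrite a0 in sS *; apply: Sigma0_open; apply: bigcup_open => k _.
  exact/Sigma0_zeroE.
have [g gP] := choice (fun k => Sigma0_posE a0 (sS k)).
have [A AP] := choice gP.
rewrite (_ : \bigcup_k S k = \bigcup_(p : K * nat) A p.1 p.2).
  apply: (@Sigma0_bigcup_count _ _ _ (fun p => g p.1 p.2)) => // -[k n] /=;
  by case: (AP k).
apply/seteqP; split=> t.
  by move=> [k _]; have [_ _ ->] := AP k => -[n _ At]; exists (k, n).
by move=> [[k n] _ At]; exists k => //; have [_ _ ->] := AP k; exists n.
Qed.

Lemma Sigma0_preimage (T U : topologicalType) (f : T -> U) (a : omega1)
    (S : set U) :
  continuous f -> Sigma0_1plus a S -> Sigma0_1plus a (f @^-1` S).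
Proof.
move=> cf; elim=> [V oV|b g A b0 gb sA IH].
  by apply: Sigma0_open; apply: open_comp oV => + _.
rewrite preimage_bigcup; exact: (@Sigma0_bigcup _ _ g).
Qed.

Lemma lt_osucc (a b : omega1) : a < b -> osucc a < osucc b.
Proof. by move=> /osucc_le ab; exact: le_lt_trans ab (osucc_gt b). Qed.

Lemma ord_zero_lt_osucc (a : omega1) : ord_zero < osucc a.
Proof. exact: le_lt_trans (omega1_bot_le a) (osucc_gt a). Qed.

Lemma lt_osucc_le (a b : omega1) : a < osucc b -> a <= b.
Proof.
by move=> ab; rewrite leNgt; apply/negP => /osucc_le; rewrite leNgt ab.
Qed.

(* Such an [f] is of Baire class 1, hence the loss of one level. *)
Lemma Sigma0_closed_coords (J I : countType)
    (f : powerset_space J -> powerset_space I) (a : omega1)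
    (S : set (powerset_space I)) :
  (forall i, closed [set A | f A i]) ->
  Sigma0_1plus a S -> Sigma0_1plus (osucc a) (f @^-1` S).
Proof.
move=> cf; elim=> [V oV|b g A b0 gb sA IH]; last first.
  rewrite preimage_bigcup.
  apply: (@Sigma0_bigcup _ _ (osucc \o g)) => [|n|n].
  - exact: ord_zero_lt_osucc.
  - exact: lt_osucc.
  - exact: IH.
rewrite (_ : f @^-1` V = \bigcup_(c : seq I * seq I)
    [set A | cylinder c (f A) /\ cylinder c `<=` V]); last first.
  apply/seteqP; split=> [A VA|A [c _ [cA]]]; last exact.
  by have [c cA cV] := open_cylinder oV VA; exists c.
apply: Sigma0_bigcupS => c.
pose W : set (powerset_space J) := [set A | forall i, i \in c.2 -> ~ f A i].
have oW : open W.
  rewrite /W; elim: (c.2) => [|j s IH].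
    rewrite (_ : [set _ | _] = setT); first exact: openT.
    by apply/seteqP; split.
  rewrite (_ : [set _ | _] = (~` [set A | f A j]) `&`
      [set A | forall i, i \in s -> ~ f A i]).
    by apply: openI => //; rewrite openC.
  apply/seteqP; split=> A /= => [H|[Qj H] i].
    by split=> [|i si]; apply: H; rewrite inE ?eqxx ?si ?orbT.
  by rewrite inE => /orP[/eqP->|/H].
(* The positive conditions of [c] are closed, the negative ones form the open set [W]. Splitting [W]
   into clopen cylinders leaves a countable union of closed sets. *)
rewrite (_ : [set A | _] = \bigcup_(d : seq J * seq J)
  [set A | [/\ forall i, i \in c.1 -> f A i, cylinder d A,
             cylinder d `<=` W & cylinder c `<=` V]]); last first.
  apply/seteqP; split=> [A [[c1 c2] cV]|A [d _ [c1 dA dW cV]]].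
    by have [d dA dW] := open_cylinder oW c2; exists d.
  by split=> //; split=> //; exact: dW.
apply: (@Sigma0_bigcup_count _ _ _ (fun=> ord_zero)) => [|d|d];
  try exact: osucc_gt.
apply: Sigma0_open; rewrite openC.
rewrite (_ : [set A | _] = \bigcap_(i in [set i | i \in c.1]) [set A | f A i] `&`
  cylinder d `&` [set _ | cylinder d `<=` W /\ cylinder c `<=` V]).
  apply: closedI; last by case: (clopen_cst (powerset_space J)
    (cylinder d `<=` W /\ cylinder c `<=` V)).
  apply: closedI; last by case: (clopen_cylinder d).
  exact: closed_bigI.
by apply/seteqP; split=> [A [c1 dA dW cV]|A [[c1 dA] [dW cV]]].
Qed.

(** * Universal sets and the failure of closure under complements *)

Definition pjoin (y x : powerset_space nat) : powerset_space (nat + nat) :=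
  fun k => match k with inl n => y n | inr n => x n end.

Lemma continuous_reindex (I J : choiceType) (r : J -> I) :
  continuous (fun A : powerset_space I => (fun j => A (r j)) : powerset_space J).
Proof. by apply: continuous_powerset => j; exact: clopen_coord. Qed.

(** At level zero the parameter lists cylinders. At a positive level its row [(n, m)] codes the
    complement of the [n]-th term of the union through the universal set of class [e m], where [e]
    enumerates the ordinals below [a]. *)
Lemma Sigma0_universal (a : omega1) :
  exists2 U : set (powerset_space (nat + nat)), Sigma0_1plus a U &
    forall B : set (powerset_space nat), Sigma0_1plus a B ->
      exists y, forall x, B x <-> U (pjoin y x).
Proof.
elim/omega1_ind: a => a IH.
have [a0|/ord_zero_eq a0] := pselect (ord_zero < a); last first.
  subst a; exists (\bigcup_(c : seq nat * seq nat)
      ([set z | z (inl (pickle c))] `&` [set z | cylinder c (fun n => z (inr n))])).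
    apply: Sigma0_open; apply: bigcup_open => c _; apply: openI.
      by case: (clopen_coord (inl (pickle c) : (nat + nat)%type)).
    have [oc _] := clopen_cylinder c.
    apply: (@open_comp _ _ (fun z : powerset_space (nat + nat) =>
      (fun n => z (inr n)) : powerset_space nat)) oc => z _.
    exact: continuous_reindex.
  move=> B /Sigma0_zeroE oB.
  exists [set k | exists2 c, k = pickle c & cylinder c `<=` B] => x; split.
    move=> Bx; have [c cx cB] := open_cylinder oB Bx.
    by exists c => //; split=> //=; exists c.
  move=> [c _ [/= [d /(pcan_inj pickleK)<- cB]]]; exact: cB.
have [e ea esurj] := omega1_enum_lt a0.
have /choice[V VP] m : exists W : set (powerset_space (nat + nat)),
    Sigma0_1plus (e m) W /\
    forall B : set (powerset_space nat), Sigma0_1plus (e m) B ->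
      exists y, forall x, B x <-> W (pjoin y x).
  by have [W W1 W2] := IH _ (ea m); exists W.
(* Reindexing by [r k] extracts row [k] of the parameter and keeps the argument. *)
pose r (k : nat * nat) (i : nat + nat) : nat + nat :=
  match i with inl n => inl (pickle (k, n)) | inr n => inr n end.
exists (\bigcup_(k : nat * nat) ~` [set z : powerset_space (nat + nat) |
    V k.2 (fun i => z (r k i))]).
  apply: (@Sigma0_bigcup_count _ _ _ (fun k => e k.2)) => // k.
  rewrite setCK; apply: (@Sigma0_preimage _ _ (fun z : powerset_space (nat + nat) =>
    (fun i => z (r k i)) : powerset_space (nat + nat)) _ (V k.2)).
    exact: continuous_reindex.
  by case: (VP k.2).
move=> B /(Sigma0_posE a0)[g [A [ga sA ->]]].
have /choice[y yP] (k : nat * nat) : exists y : powerset_space nat, forall x,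
    ~ V k.2 (pjoin y x) <-> (e k.2 = g k.1 /\ A k.1 x).
  case: k => n m /=; have [_ uV] := VP m.
  (* When [e m] is not the class of the [n]-th term, the row codes the whole space, whose complement
     adds nothing to the union. *)
  have [emn|emn] := pselect (e m = g n); last first.
    have [y yP] := uV _ (Sigma0_setT _ _).
    by exists y => x; split=> [|[]//]; case; apply/yP.
  have [|y yP] := uV (~` A n); first by rewrite emn.
  exists y => x; split=> [H|[_ An]].
    by split=> //; apply: contrapT => nA; apply: H; apply/yP.
  by move=> /yP.
pose Y : powerset_space nat :=
  [set j | exists (k : nat * nat) (i : nat), j = pickle (k, i) /\ y k i].
exists Y => x.
have E k : (fun i => pjoin Y x (r k i))
    = pjoin (y k) x.
  apply/funext => -[] n //=; apply/propext; split=> [[l [i []]]|yn].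
    by move=> /(pcan_inj pickleK)[-> ->].
  by exists k, n.
split=> [[n _ An]|[k _ nV]].
  have [m em] := esurj _ (ga n); exists (n, m) => //.
  suff : ~ V m (pjoin (y (n, m)) x) by rewrite -(E (n, m)).
  by apply/(yP (n, m)).
have /yP[_ Ak] : ~ V k.2 (pjoin (y k) x) by rewrite -E.
by exists k.1.
Qed.

(** Diagonal argument: a code [y] for the complement of the diagonal section of [U] is contradictory
    at the point [y]. *)
Lemma Sigma0_not_compl (a : omega1) : exists2 B : set (powerset_space nat),
  Sigma0_1plus a B & ~ Sigma0_1plus a (~` B).
Proof.
have [U sU uU] := Sigma0_universal a.
exists [set x | U (pjoin x x)].
  apply: (@Sigma0_preimage _ _ (fun x : powerset_space nat => pjoin x x)) sU.
  by apply: continuous_powerset => -[] n; exact: clopen_coord.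
move=> /uU[y /(_ y)/= [H1 H2]].
have nU : ~ U (pjoin y y) by move=> u; exact: (H2 u u).
exact: nU (H1 nU).
Qed.

(** * Analyticity, pullbacks and separation *)

Lemma baire_reindex_continuous (r : nat -> nat) :
  continuous (fun z : baire_space => (fun n => z (r n)) : baire_space).
Proof.
apply: continuous_prod => n.
exact: (@proj_continuous nat (fun=> nat) (r n)).
Qed.

Lemma clopen_baire_reindex (I : choiceType) (f : baire_space -> powerset_space I)
    (r : nat -> nat) i :
  continuous f -> clopen [set z : baire_space | f (fun n => z (r n)) i].
Proof.
move=> cf; apply: (@preimage_clopen _ _
    (fun z : baire_space => (fun n => z (r n)) : baire_space)
    [set z | f z i]); first exact: continuous_coord.
exact: baire_reindex_continuous.
Qed.

(** A general countable index type allows a parameter to be assembled from several pieces by sum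
    types. *)
Lemma analytic_range (K : countType) (I : Type)
    (Phi : (K -> nat) -> powerset_space I) :
  (forall i, clopen [set z : baire_space | Phi (fun k => z (pickle k)) i]) ->
  analytic (range Phi).
Proof.
move=> cPhi; right; exists (fun z : baire_space => Phi (fun k => z (pickle k))).
  exact: continuous_powerset.
apply/seteqP; split=> _ [w _ <-]; last by exists (fun k => w (pickle k)).
exists (fun n => if unpickle n is Some k then w k else 0%N) => //.
by congr Phi; apply/funext => k; rewrite pickleK.
Qed.

Lemma analytic_filter_param (I : Type) (H : set_system I) : analytic_filter H ->
  exists2 f : baire_space -> powerset_space I, continuous f & H = range f.
Proof.
move=> [PH [H0|//]].
have : H setT by exact: filterT.
by rewrite H0.
Qed.

Definition pullback (Y X : Type) (p : Y -> X) (H : set_system X) : set_system Y :=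
  [set A | exists2 C, H C & p @^-1` C `<=` A].

Lemma pullback_filter (Y X : Type) (p : Y -> X) (H : set_system X) :
  Filter H -> Filter (pullback p H).
Proof.
move=> FH; split.
- by exists setT => //; exact: filterT.
- move=> A B [C HC CA] [D HD DB]; exists (C `&` D); first exact: filterI.
  by move=> y [Cy Dy]; split; [exact: CA|exact: DB].
- by move=> A B AB [C HC CA]; exists C => //; exact: subset_trans AB.
Qed.

Lemma pullback_proper (Y X : Type) (p : Y -> X) (s : X -> Y) (H : set_system X) :
  cancel s p -> ProperFilter H -> ProperFilter (pullback p H).
Proof.
move=> sp PH; split; last exact: pullback_filter.
move=> [C HC C0]; have [x Cx] := filter_ex HC.
by apply: (C0 (s x)); rewrite /= sp.
Qed.

(** The case [q = p] gives the analyticity of a single pullback. *)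
Lemma analytic_pullbackI (Y : countType) (X : choiceType) (p q : Y -> X)
    (H : set_system X) : analytic_filter H ->
  analytic (pullback p H `&` pullback q H : set (powerset_space Y)).
Proof.
move=> /[dup] -[PH _] /analytic_filter_param[f cf Hf].
(* Two components code members of [H]; the third adds arbitrary points, so that all supersets of the
   union of the two preimages are reached. *)
pose Phi (w : nat + nat + Y -> nat) : powerset_space Y := fun y =>
  (f (fun n => w (inl (inl n))) (p y) \/ f (fun n => w (inl (inr n))) (q y)) \/
  w (inr y) = 1%N.
rewrite (_ : _ `&` _ = range Phi).
  apply: analytic_range => y; apply: clopenU; last exact: clopen_baire_coord.
  by apply: clopenU; exact: clopen_baire_reindex.
apply/seteqP; split=> [A [[C HC CA] [D HD DA]]|_ [w _ <-]].
  move: HC HD; rewrite {1 2}Hf => -[c _ cC] [d _ dD].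
  exists (fun k => match k with inl (inl n) => c n | inl (inr n) => d n
                   | inr y => `[< A y >] : nat end) => //.
  apply/funext => y; rewrite /Phi /= cC dD; apply/propext; split.
    by move=> [[/CA|/DA]//|]; case: asboolP.
  by move=> Ay; right; rewrite asboolT.
split.
  exists (f (fun n => w (inl (inl n)))); first by rewrite Hf; exists (fun n => w (inl (inl n))).
  by move=> y ?; left; left.
exists (f (fun n => w (inl (inr n)))); first by rewrite Hf; exists (fun n => w (inl (inr n))).
by move=> y ?; left; right.
Qed.

Lemma Sigma0_separatedP (I : Type) (H : set_system I) (a : omega1) :
  Sigma0_separated H a <-> exists S : set (powerset_space I),
    [/\ Sigma0_1plus a S, H `<=` S & forall A, S A -> ~ H (~` A)].
Proof.
split=> -[S [sS HS S0]]; exists S; split=> //.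
  by move=> A SA HA; have : set0 A by rewrite -S0.
by apply/seteqP; split=> // A [/S0].
Qed.

(** Taking preimages under [s] maps the pullback into [H] and its dual into the dual of [H];
    preimages under [p] do the same in the other direction. Both maps are continuous, so separators
    transfer both ways without change of class. *)
Lemma has_rank_pullback (Y : countType) (X : choiceType) (p : Y -> X)
    (s : X -> Y) (H : set_system X) (a : omega1) :
  cancel s p -> has_rank H a -> has_rank (pullback p H) a.
Proof.
move=> sp [[PH aH] /Sigma0_separatedP[S [sS HS S0]] minH]; split.
- split; first exact: pullback_proper sp PH.
  by rewrite -[pullback p H]setIid; exact: analytic_pullbackI.
- apply/Sigma0_separatedP; exists [set A | S (fun x => A (s x))]; split.
  + apply: (@Sigma0_preimage _ _ (fun A : powerset_space Y =>
      (fun x => A (s x)) : powerset_space X)) sS.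
    exact: continuous_reindex.
  + move=> A [C HC CA]; apply: HS; apply: filterS HC => x Cx.
    by apply: CA; rewrite /= sp.
  + move=> A SA [C HC CA]; apply: (S0 _ SA); apply: filterS HC => x Cx.
    by apply: (CA (s x)); rewrite /= sp.
- move=> b /Sigma0_separatedP[S' [sS' HS' S'0]]; apply: minH.
  apply/Sigma0_separatedP; exists [set C | S' (p @^-1` C)]; split.
  + apply: (@Sigma0_preimage _ _ (fun C : powerset_space X =>
      (fun y => C (p y)) : powerset_space Y)) sS'.
    exact: continuous_reindex.
  + by move=> C HC; apply: HS'; exists C.
  + by move=> C SC HC; apply: (S'0 _ SC); exists (~` C).
Qed.

(** Complementation of subsets of [I] exchanges [H] with its dual, so a separator of one pair yields
    the complement of a separator of the other. *)
Lemma Pi0_separated (I : choiceType) (H : set_system I) (a : omega1) :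
  Sigma0_separated H a ->
  exists P : set (powerset_space I),
    [/\ Sigma0_1plus a (~` P), H `<=` P & forall A, P A -> ~ H (~` A)].
Proof.
move=> /Sigma0_separatedP[S [sS HS S0]]; exists [set A | ~ S (~` A)]; split.
- rewrite (_ : ~` _ = (fun A : powerset_space I =>
      (~` (A : set I)) : powerset_space I) @^-1` S).
    apply: Sigma0_preimage sS; apply: continuous_powerset => i.
    by apply: clopenN; exact: clopen_coord.
  by apply/seteqP; split=> A /=; [exact: contrapT|move=> SA; exact].
- by move=> A HA /S0; rewrite setCK.
- by move=> A nSA /HS.
Qed.

(** * Wadge reductions to a filter and its dual as lower bounds for the rank *)

Definition reduces (B : set (powerset_space nat)) (H : set_system nat) :=
  exists2 phi : powerset_space nat -> powerset_space nat, continuous phi &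
    forall x, (B x -> H (phi x)) /\ (~ B x -> H (~` (phi x : set nat))).

Lemma reducesC B H : reduces B H -> reduces (~` B) H.
Proof.
move=> [phi cphi phiP]; exists (fun x => (~` (phi x : set nat)) : powerset_space nat).
  by apply: continuous_powerset => i; apply: clopenN; exact: continuous_coord.
move=> x; have [p1 p2] := phiP x; split=> //.
by rewrite setCK => /contrapT.
Qed.

Lemma reduces_clopen B H : Filter H -> clopen B -> reduces B H.
Proof.
move=> FH cB; exists (fun x => [set _ | B x]); first exact: continuous_powerset.
by move=> x; split=> Bx; apply: filterS filterT.
Qed.

(* The last clause forces the rank to be at least [a]. *)
Definition rank_witness (a : omega1) (H : set_system nat) : Prop :=
  [/\ analytic_filter H, Sigma0_separated H a &
      forall b B, b < a -> Sigma0_1plus b B -> reduces B H].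

(** A separator of class [b < a] pulls back along a reduction of the complement of [B] to that
    complement itself. It would thus have class [b], for every [B] of class [b]. *)
Lemma has_rank_witness a H : rank_witness a H -> has_rank H a.
Proof.
move=> [aH sH rH]; split=> // b /Sigma0_separatedP[S [sS HS S0]].
rewrite leNgt; apply/negP => ba.
have [B sB nsB] := Sigma0_not_compl b; apply: nsB.
have [phi cphi phiP] := reducesC (rH _ _ ba sB).
rewrite (_ : ~` B = phi @^-1` S); first exact: Sigma0_preimage.
apply/seteqP; split=> x; have [p1 p2] := phiP x.
  by move=> /p1/HS.
by move=> Sx nBx; apply: (S0 _ Sx); apply: p2; exact.
Qed.

(** * Rank zero, and the successor step by products with the Frechet filter *)

Lemma rank_witness_principal : rank_witness ord_zero [set A | A 0%N].
Proof.
split.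
- split.
    split; first by [].
    by split=> // A B AB A0; exact: AB.
  pose Phi (w : nat -> nat) : powerset_space nat :=
    fun n => n = 0%N \/ w n = 1%N.
  rewrite (_ : [set A | _] = range Phi).
    apply: analytic_range => n; apply: clopenU; first exact: clopen_cst.
    exact: clopen_baire_coord.
  apply/seteqP; split=> [A A0|_ [w _ <-]]; last by left.
  exists (fun n => `[< A n >] : nat) => //.
  apply/funext => n; apply/propext; split.
    by move=> [->//|]; case: asboolP.
  by move=> An; right; rewrite asboolT.
- apply/Sigma0_separatedP; exists [set A | A 0%N]; split=> //.
    by apply: Sigma0_open; case: (clopen_coord 0%N).
  by move=> A A0; exact.
- by move=> b B b0; have := le_lt_trans (omega1_bot_le b) b0; rewrite ltxx.
Qed.

(* The product of the Frechet filter with [H], coded on [nat] by [pickle]; the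
   points outside the range of [pickle] are irrelevant. *)
Definition frechet_prod (H : set_system nat) : set_system nat :=
  [set A | exists n, forall i, (n <= i)%N -> H [set x | A (pickle (i, x))]].

Lemma frechet_prod_proper H : ProperFilter H -> ProperFilter (frechet_prod H).
Proof.
move=> PH; split; first by move=> [n /(_ n (leqnn n))/filter_ex[]].
split.
- by exists 0%N => i _; exact: filterT.
- move=> A B [n nA] [m mB]; exists (maxn n m) => i.
  by rewrite geq_max => /andP[/nA HA /mB HB]; exact: filterI HA HB.
- by move=> A B AB [n nA]; exists n => i /nA; apply: filterS => x; exact: AB.
Qed.

Lemma analytic_frechet_prod H : analytic_filter H ->
  analytic (frechet_prod H : set (powerset_space nat)).
Proof.
move=> /[dup] -[PH _] /analytic_filter_param[f cf Hf].
(* The coordinate [inl None] is the threshold, [inl (Some (i, n))] codes the fiber over [i] from the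
   threshold on, and [inr] is a characteristic function that decides all remaining points. *)
pose Phi (w : option (nat * nat) + nat -> nat) : powerset_space nat := fun k =>
  if (pickle_inv k : option (nat * nat)) is Some (i, x) then
    if (i < w (inl None))%N then w (inr k) = 1%N
    else f (fun n => w (inl (Some (i, n)))) x
  else w (inr k) = 1%N.
rewrite (_ : frechet_prod H = range Phi).
  apply: analytic_range => k; rewrite /Phi.
  case: (pickle_inv k) => [[i x]|]; last exact: clopen_baire_coord.
  pose c (k : option (nat * nat) + nat) := pickle k.
  pose Q n : set baire_space := if (i < n)%N then [set z | z (c (inr k)) = 1%N]
    else [set z | f (fun m => z (c (inl (Some (i, m))))) x].
  rewrite (_ : [set _ | _] = [set z | Q (z (c (inl None))) z]); last first.
    by apply/funext => z; rewrite /Q /=; case: ifP.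
  apply: clopen_cases => n; first exact: clopen_baire_coord.
  rewrite /Q; case: ifP => _; first exact: clopen_baire_coord.
  exact: clopen_baire_reindex.
apply/seteqP; split=> [A [n nA]|_ [w _ <-]].
  have /choice[z zP] i : exists z, (n <= i)%N -> f z = [set x | A (pickle (i, x))].
    have [ni|ni] := boolP (n <= i)%N; last by exists (fun=> 0%N).
    by move: (nA _ ni); rewrite Hf => -[z _ <-]; exists z.
  exists (fun k => match k with inl None => n | inl (Some (i, m)) => z i m
                   | inr k => `[< A k >] : nat end) => //.
  have E k : (`[< A k >] : nat) = 1%N <-> A k by case: asboolP.
  apply/funext => k; apply/propext; rewrite /Phi /=.
  have := pickle_invK (T := (nat * nat)%type) k.
  case: (pickle_inv k) => [[i x]|] /= ek; last by split=> /E.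
  case: ltnP => ni; first by split=> /E.
  by rewrite zP //= ek.
exists (w (inl None)) => i ni; rewrite Hf.
exists (fun n => w (inl (Some (i, n)))) => //.
apply/funext => x; rewrite /= /Phi pickleK_inv ltnNge ni //.
Qed.

(* Finite unions are taken in the target, where [H] and its dual absorb them, so
   the sets [B n] need not be increasing. *)
Lemma reduces_bigcup (B : nat -> set (powerset_space nat)) H : Filter H ->
  (forall n, reduces (B n) H) -> reduces (\bigcup_n B n) (frechet_prod H).
Proof.
move=> FH rB.
have /choice[phi phiP] n : exists phi : powerset_space nat -> powerset_space nat,
    continuous phi /\
    forall x, (B n x -> H (phi x)) /\ (~ B n x -> H (~` (phi x : set nat))).
  by have [phi ? ?] := rB n; exists phi.
pose psi n x : set nat := [set y | exists2 k, (k <= n)%N & phi k x y].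
have psi0 x : psi 0%N x = phi 0%N x.
  by apply/seteqP; split=> y => [[k]|]; [rewrite leqn0 => /eqP->|exists 0%N].
have psiS n x : psi n.+1 x = psi n x `|` phi n.+1 x.
  apply/seteqP; split=> y => [[k]|[[k kn]|]].
  - by rewrite leq_eqVlt => /orP[/eqP->|kn]; [right|left; exists k].
  - by exists k => //; exact: leqW.
  - by exists n.+1.
exists (fun x k => if (unpickle k : option (nat * nat)) is Some (n, y)
                   then psi n x y else False).
  apply: continuous_powerset => k; case: unpickle => [[n y]|]; last first.
    exact: clopen_cst.
  have cphi k' : clopen [set x | phi k' x y].
    by apply: continuous_coord; case: (phiP k').
  elim: n => [|n IH].
    rewrite (_ : [set _ | _] = [set x | phi 0%N x y]) //.
    by apply/seteqP; split=> x /=; rewrite psi0.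
  rewrite (_ : [set _ | _] = [set x | psi n x y] `|` [set x | phi n.+1 x y]).
    exact: clopenU.
  by apply/seteqP; split=> x /=; rewrite psiS.
move=> x; split=> [[k _ Bk]|nB].
  (* Every fiber from [k] on contains [phi k x], a member of [H]. *)
  exists k => n kn; have [_ /(_ x)[/(_ Bk) Hk _]] := phiP k.
  by apply: filterS Hk => y phiy /=; rewrite pickleK; exists k.
exists 0%N => n _.
rewrite (_ : [set _ | _] = ~` psi n x); last first.
  by apply/seteqP; split=> y /=; rewrite pickleK.
have nphi k : H (~` (phi k x : set nat)).
  have [_ /(_ x)[_]] := phiP k; apply=> Bk; apply: nB; exists k => //.
elim: n => [|n IH]; first by rewrite psi0.
by rewrite psiS setCU; exact: filterI.
Qed.

Lemma rank_witness_frechet_prod a H : rank_witness a H -> rank_witness (osucc a) (frechet_prod H).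
Proof.
move=> [aH sH rH]; have [PH _] := aH; split.
- by split; [exact: frechet_prod_proper|exact: analytic_frechet_prod].
(* Separating each fiber by a Pi^0 set keeps the lim inf at one level higher. *)
- have [P [sP HP P0]] := Pi0_separated sH.
  apply/Sigma0_separatedP; exists (\bigcup_n ~` \bigcup_j
    [set A : powerset_space nat | ~ P [set x | A (pickle ((n + j)%N, x))]]); split.
  + apply: (@Sigma0_bigcup _ _ (fun=> a)) => [|n|n].
    * exact: ord_zero_lt_osucc.
    * exact: osucc_gt.
    * rewrite setCK; apply: Sigma0_bigcupS => j.
      apply: (@Sigma0_preimage _ _ (fun A : powerset_space nat =>
        (fun x => A (pickle ((n + j)%N, x))) : powerset_space nat)) sP.
      exact: continuous_reindex.
  + move=> A [n nA]; exists n => // -[j _]; apply.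
    by apply: HP; apply: nA; exact: leq_addr.
  + move=> A [n _ nP] [m mA].
    have PA : P [set x | A (pickle ((n + m)%N, x))].
      by apply: contrapT => nPA; apply: nP; exists m.
    by apply: (P0 _ PA); exact: mA (leq_addl _ _).
- move=> b B /lt_osucc_le; rewrite le_eqVlt => /orP[/eqP->|ba] sB; last first.
    rewrite (_ : B = \bigcup_(n : nat) B).
      by apply: reduces_bigcup => n; exact: rH sB.
    by apply/seteqP; split=> [x Bx|x []//]; exists 0%N.
  (* The new case [b = a]: [B] is a countable union of sets whose complements have classes below
     [a], or of clopen sets if [a] is zero. *)
  have [a0|/ord_zero_eq a0] := pselect (ord_zero < a).
    have [g [A [ga sA ->]]] := Sigma0_posE a0 sB.
    apply: reduces_bigcup => n; rewrite -[A n]setCK; apply: reducesC.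
    exact: rH (sA n).
  rewrite a0 in sB; move/Sigma0_zeroE: sB => /open_bigcup_cylinder->.
  apply: reduces_bigcup => n; apply: reduces_clopen.
  case: unpickle => [c|]; last exact: clopen0.
  by apply: clopenI; [exact: clopen_cylinder|exact: clopen_cst].
Qed.

Lemma frechet_prod_snd H : Filter H -> exists p : nat -> nat,
  forall C, H C <-> frechet_prod H (p @^-1` C).
Proof.
move=> FH; pose p (k : nat) := oapp snd 0%N (unpickle k : option (nat * nat)).
exists p => C.
have E (i : nat) : [set x | C (p (pickle (i, x)))] = C.
  by apply/funext => x; rewrite /p /mkset pickleK.
by split=> [HC|[n /(_ n (leqnn n))]]; [exists 0%N => i _|]; rewrite /= E.
Qed.

(** * Limits of chains of filters, and filters of every rank *)

Section chain_limit.
Variables (H : nat -> set_system nat) (p : nat -> nat -> nat).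
Hypothesis PH : forall n, ProperFilter (H n).
Hypothesis Hp : forall n C, H n C <-> H n.+1 (p n @^-1` C).

(* The map from stage [m] down to stage [n] (the identity if [m <= n]). *)
Fixpoint chain_proj (m n x : nat) : nat :=
  if m is m'.+1 then
    if (n <= m')%N then chain_proj m' n (p m' x) else x
  else x.

Lemma chain_proj_id m n x : (m <= n)%N -> chain_proj m n x = x.
Proof. by case: m => //= m mn; rewrite leqNgt mn. Qed.

Lemma chain_proj_comp k n m x : (k <= n)%N -> (n <= m)%N ->
  chain_proj n k (chain_proj m n x) = chain_proj m k x.
Proof.
move=> kn; elim: m x => [|m IH] x; first by rewrite leqn0 => /eqP->.
rewrite leq_eqVlt => /orP[/eqP->|]; first by rewrite (@chain_proj_id m.+1 m.+1).
by rewrite ltnS => nm /=; rewrite nm (leq_trans kn nm) IH.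
Qed.

Lemma chain_projP n m C : (n <= m)%N ->
  H n C <-> H m [set x | C (chain_proj m n x)].
Proof.
elim: m C => [|m IH] C; first by rewrite leqn0 => /eqP->.
rewrite leq_eqVlt => /orP[/eqP->|].
  rewrite (_ : [set _ | _] = C) //.
  by apply/seteqP; split=> x /=; rewrite ltnn.
rewrite ltnS => nm; apply: iff_trans (IH C nm) _; apply: iff_trans (Hp _ _) _.
rewrite (_ : p m @^-1` _ = [set x | C (chain_proj m.+1 n x)]) //.
by apply/seteqP; split=> x /=; rewrite nm.
Qed.

(* The union of the pullbacks of the [H n] to the disjoint union of the stages
   [m >= n]. *)
Definition chain_lim : set_system nat :=
  [set A | exists n, exists2 C, H n C &
    forall m x, (n <= m)%N -> C (chain_proj m n x) -> A (pickle (m, x))].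

Lemma chain_lim_proper : ProperFilter chain_lim.
Proof.
split.
  move=> [n [C HC nC]]; have [x Cx] := filter_ex HC.
  by apply: (nC n x) => //; rewrite chain_proj_id.
split.
- by exists 0%N, setT => //; exact: filterT.
- move=> A B [n [C HC CA]] [m [D HD DB]].
  have nk := leq_maxl n m; have mk := leq_maxr n m.
  exists (maxn n m), ([set x | C (chain_proj (maxn n m) n x)] `&`
    [set x | D (chain_proj (maxn n m) m x)]).
    by apply: filterI; [apply/(chain_projP _ nk)|apply/(chain_projP _ mk)].
  move=> l x kl /= []; rewrite !chain_proj_comp // => Cx Dx.
  by split; [apply: CA => //|apply: DB => //]; apply: leq_trans kl.
- by move=> A B AB [n [C HC CA]]; exists n, C => // m x nm /(CA _ _ nm)/AB.
Qed.

Lemma analytic_chain_lim : (forall n, analytic (H n : set (powerset_space nat))) ->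
  analytic (chain_lim : set (powerset_space nat)).
Proof.
move=> aH.
have /choice[f fP] n : exists f : baire_space -> powerset_space nat,
    continuous f /\ H n = range f.
  by have [|f ? ?] := @analytic_filter_param _ (H n); [split|exists f].
(* The coordinate [inl None] is a stage [n], the [inl (Some j)] code a member of [H n], and [inr]
   adds arbitrary points. *)
pose Phi (w : option nat + nat -> nat) : powerset_space nat := fun k =>
  w (inr k) = 1%N \/
  if (pickle_inv k : option (nat * nat)) is Some (m, x) then
    (w (inl None) <= m)%N /\
    f (w (inl None)) (fun n => w (inl (Some n))) (chain_proj m (w (inl None)) x)
  else False.
rewrite (_ : chain_lim = range Phi).
  apply: analytic_range => k; rewrite /Phi.
  apply: clopenU; first exact: clopen_baire_coord.
  case: (pickle_inv k) => [[m x]|]; last exact: clopen_cst.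
  pose c (k : option nat + nat) := pickle k.
  pose Q n : set baire_space := [set z | (n <= m)%N /\
    f n (fun j => z (c (inl (Some j)))) (chain_proj m n x)].
  suff : clopen [set z : baire_space | Q (z (c (inl None))) z] by [].
  apply: clopen_cases => n.
    exact: clopen_baire_coord.
  apply: clopenI; first exact: clopen_cst.
  by apply: clopen_baire_reindex; case: (fP n).
apply/seteqP; split=> [A [n [C HC CA]]|_ [w _ <-]].
  have [_ En] := fP n; move: HC; rewrite En => -[z _ zC].
  exists (fun k => match k with inl None => n | inl (Some j) => z j
                   | inr k => `[< A k >] : nat end) => //.
  have E k : (`[< A k >] : nat) = 1%N <-> A k by case: asboolP.
  apply/funext => k; apply/propext; rewrite /Phi /=.
  split=> [[/E//|]|/E]; last by left.
  have := pickle_invK (T := (nat * nat)%type) k.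
  case: (pickle_inv k) => [[m x]|] //= <- [nm].
  by rewrite zC; exact: CA.
exists (w (inl None)), (f (w (inl None)) (fun n => w (inl (Some n)))).
  by have [_ ->] := fP (w (inl None)); exists (fun n => w (inl (Some n))).
by move=> m x nm fx; right; rewrite pickleK_inv.
Qed.

(** A set belongs to the limit exactly when its image under some [psi n] belongs to [H n]. The
    coordinates of [psi n] are closed conditions, which costs one level; the bound on
    [osucc (lam n)] leaves room for it. *)
Lemma separated_chain_lim (a : omega1) (lam : nat -> omega1) :
  (forall n, Sigma0_separated (H n) (lam n)) ->
  (forall n, osucc (lam n) < a) -> Sigma0_separated chain_lim a.
Proof.
move=> sH la; have /choice[P PP] n := Pi0_separated (sH n).
(* [psi n A] is the largest set at stage [n] whose pullback is contained in [A]. *)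
pose psi n (A : powerset_space nat) : powerset_space nat := fun x =>
  forall m y, (n <= m)%N -> chain_proj m n y = x -> A (pickle (m, y)).
apply/Sigma0_separatedP; exists (\bigcup_n (psi n @^-1` P n)); split.
- apply: (@Sigma0_bigcup _ _ (osucc \o lam)) => //.
    exact: le_lt_trans (omega1_bot_le _) (la 0%N).
  move=> n; rewrite preimage_setC; apply: Sigma0_closed_coords; last by case: (PP n).
  move=> x; rewrite (_ : [set A | _] =
    \bigcap_(k in [set k : nat * nat | (n <= k.1)%N /\ chain_proj k.1 n k.2 = x])
      [set A : powerset_space nat | A (pickle k)]).
    by apply: closed_bigI => k _; case: (clopen_coord (pickle k)).
  apply/seteqP; split=> A /= => [psiA [m y] [/= nm xy]|cA m y nm xy].
    exact: psiA.
  exact: (cA (m, y)).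
- move=> A [n [C HC CA]]; exists n => //.
  have [_ HP _] := PP n; apply: HP; apply: filterS HC => x Cx m y nm xy.
  by apply: CA => //; rewrite xy.
- move=> A [n _ /= PA] [k [D HD DA]].
  have [_ _ P0] := PP n; apply: (P0 _ PA).
  have nm := leq_maxl n k; have km := leq_maxr n k.
  (* At the common stage [maxn n k], a point over [D] is outside [A], so its projection to stage [n]
     cannot lie in [psi n A]. *)
  apply/(chain_projP _ nm).
  move/(chain_projP _ km): HD; apply: filterS => y Dy /= psiy.
  by apply: (DA _ y km Dy); exact: psiy.
Qed.

Lemma reduces_chain_lim n B : reduces B (H n) -> reduces B chain_lim.
Proof.
move=> [phi cphi phiP].
exists (fun x k => if (unpickle k : option (nat * nat)) is Some (m, y)
                   then (n <= m)%N /\ phi x (chain_proj m n y) else False).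
  apply: continuous_powerset => k; case: unpickle => [[m y]|]; last first.
    exact: clopen_cst.
  by apply: clopenI; [exact: clopen_cst|exact: continuous_coord].
move=> x; have [p1 p2] := phiP x.
split=> [/p1|/p2] Hx; exists n; [exists (phi x)|exists (~` (phi x : set nat))] => //.
  by move=> m y nm phiy; rewrite pickleK.
by move=> m y nm phiy /=; rewrite pickleK => -[].
Qed.

Lemma chain_lim_proj : exists q : nat -> nat,
  forall C, H 0%N C <-> chain_lim (q @^-1` C).
Proof.
pose q (k : nat) := if (unpickle k : option (nat * nat)) is Some (m, x)
  then chain_proj m 0 x else 0%N.
exists q => C.
split=> [HC|[n [D HD DC]]].
  by exists 0%N, C => // m x _ Cx; rewrite /= /q pickleK.
apply/(@chain_projP 0 n) => //; apply: filterS HD => x Dx /=.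
by have := DC n x (leqnn n); rewrite chain_proj_id //= /q pickleK; exact.
Qed.

End chain_limit.

(** Extending a given filter, rather than only finding one for [d], is what lets the filters chosen
    below a limit form a chain. *)
Lemma rank_witness_extension (d c : omega1) (H : set_system nat) : c <= d -> rank_witness c H ->
  exists H' : set_system nat, exists p : nat -> nat,
    rank_witness d H' /\ forall C, H C <-> H' (p @^-1` C).
Proof.
elim/omega1_ind: d c H => d IH c H.
rewrite le_eqVlt => /orP[/eqP<-|cd] gH; first by exists H, id.
have [[e de]|nsucc] := pselect (exists e, d = osucc e).
  have ed : e < d by rewrite de; exact: osucc_gt.
  have ce : c <= e by apply: lt_osucc_le; rewrite -de.
  have [H1 [p [gH1 p1P]]] := IH _ ed _ _ ce gH.
  have FH1 : Filter H1 by case: gH1 => -[[]].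
  have [q qP] := frechet_prod_snd FH1.
  exists (frechet_prod H1), (p \o q); split.
    by rewrite de; exact: rank_witness_frechet_prod.
  by move=> C; exact: iff_trans (p1P C) (qP _).
have succ_lt b : b < d -> osucc b < d.
  move=> bd; rewrite lt_neqAle osucc_le // andbT; apply/eqP => bE.
  by apply: nsucc; exists b.
have d0 : ord_zero < d by exact: le_lt_trans (omega1_bot_le c) cd.
have [e ed esurj] := omega1_enum_lt d0.
(* Running maxima of an enumeration of the ordinals below [d] give a nondecreasing cofinal sequence
   that starts at [c]. *)
pose lam := fix lam n := if n is m.+1 then Order.max (lam m) (e m) else c.
have lamd n : lam n < d.
  by elim: n => //= n IHn; rewrite gt_max IHn ed.
have /choice[next nextP] (s : nat * set_system nat) :
    exists t : set_system nat * (nat -> nat), rank_witness (lam s.1) s.2 ->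
      rank_witness (lam s.1.+1) t.1 /\ forall C, s.2 C <-> t.1 (t.2 @^-1` C).
  case: s => n K; have [gK|nK] := pselect (rank_witness (lam n) K); last by exists (K, id).
  have [|K' [q [gK' qP]]] := IH _ (lamd n.+1) (lam n) K _ gK.
    by rewrite /= le_max lexx.
  by exists (K', q).
pose Hs := fix Hs n := if n is m.+1 then (next (m, Hs m)).1 else H.
have gHs n : rank_witness (lam n) (Hs n).
  by elim: n => //= n IHn; case: (nextP (n, Hs n) IHn).
pose p n := (next (n, Hs n)).2.
have Hp n C : Hs n C <-> Hs n.+1 (p n @^-1` C).
  by case: (nextP (n, Hs n) (gHs n)) => _; exact.
have PH n : ProperFilter (Hs n) by case: (gHs n) => -[].
have [q qP] := chain_lim_proj PH Hp.
exists (chain_lim Hs p), q; split=> //; split.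
- split; first exact: chain_lim_proper.
  by apply: analytic_chain_lim => // n; case: (gHs n) => -[].
- apply: (@separated_chain_lim _ _ PH Hp _ lam) => n; first by case: (gHs n).
  exact: succ_lt.
(* As [d] is a limit, [osucc b] is some [e m], so [lam m.+1] exceeds [b] strictly and stage [m.+1]
   already reduces [B]. *)
- move=> b B bd sB; have [m em] := esurj _ (succ_lt _ bd).
  apply: (@reduces_chain_lim _ _ m.+1).
  have [_ _] := gHs m.+1; apply; last exact: sB.
  by apply: lt_le_trans (osucc_gt b) _; rewrite -em /= le_max lexx orbT.
Qed.

Lemma has_rank_exists (a : omega1) : exists H : set_system nat, has_rank H a.
Proof.
have [H [_ [gH _]]] := rank_witness_extension (omega1_bot_le a) rank_witness_principal.
by exists H; exact: has_rank_witness.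
Qed.

(** * The collapse to rank one *)

Lemma has_rank_free (I : choiceType) (H : set_system I) (a : omega1) (s : seq I) :
  ord_zero < a -> has_rank H a -> H [set x | x \notin s].
Proof.
move=> a0 [[PH _] _ minH].
have free1 x : H (~` [set x]).
  (* Otherwise every member of [H] contains [x], and the clopen condition [A x] separates at level
     zero. *)
  apply: contrapT => nH; suff /minH : Sigma0_separated H ord_zero.
    by rewrite leNgt a0.
  apply/Sigma0_separatedP; exists [set A | A x]; split.
  - by apply: Sigma0_open; case: (clopen_coord x).
  - move=> A HA; apply: contrapT => nAx; apply: nH; apply: filterS HA => y Ay yx.
    by apply: nAx; rewrite -yx.
  - move=> A Ax HA; apply: nH; apply: filterS HA => y nAy yx.
    by apply: nAy; rewrite yx.
elim: s => [|x s IH]; first by apply: filterS filterT.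
apply: filterS (filterI (free1 x) IH) => y [/= /eqP yx ys].
by rewrite inE negb_or yx.
Qed.

Lemma has_rank_pullbackI (H : set_system nat) (a : omega1) :
  ord_zero < a -> has_rank H a ->
  has_rank (pullback (@fst nat nat) H `&` pullback (@snd nat nat) H) ord_one.
Proof.
move=> a0 rH; have [aH _ _] := rH; have [PH _] := aH.
have ne0 (C : set nat) : H C -> exists x, C x by exact: filter_ex.
split.
- split; last exact: analytic_pullbackI.
  have PF := @pullback_proper _ _ (@fst nat nat) (fun x => (x, 0%N)) H
    (fun=> erefl) PH.
  have FF : Filter (pullback (@snd nat nat) H) by exact: pullback_filter.
  split; first by move=> [/filter_not_empty].
  split.
  + by split; exact: filterT.
  + by move=> A B [A1 A2] [B1 B2]; split; exact: filterI.
  + by move=> A B AB [A1 A2]; split; [exact: filterS A1|exact: filterS A2].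
- apply/Sigma0_separatedP.
  exists (\bigcup_(x : nat) [set A : powerset_space (nat * nat) | forall y, A (x, y)]).
  split.
  + apply/Sigma0_oneE.
    exists (fun x => [set A : powerset_space (nat * nat) | forall y, A (x, y)]) => // x.
    rewrite (_ : [set A | _] = \bigcap_(y : nat)
      [set A : powerset_space (nat * nat) | A (x, y)]).
      by apply: closed_bigI => y _; case: (clopen_coord (x, y)).
    by apply/seteqP; split=> A xA y => [_|]; [exact: xA|exact: (xA y I)].
  + move=> A [[C /ne0[x Cx] CA] _]; exists x => // y; exact: CA.
  (* The vertical line over [x] inside [A] meets the horizontal line at height [y] inside the
     complement. *)
  + move=> A [x _ xA] [_ [D /ne0[y Dy] DA]].
    by apply: (DA (x, y)).
- move=> b /Sigma0_separatedP[S [sS FS S0]]; rewrite leNgt; apply/negP => b1.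
  have bE : b = ord_zero.
    apply/eqP; rewrite eq_le; apply/andP; split; first exact: lt_osucc_le.
    exact: omega1_bot_le.
  rewrite bE in sS; move/Sigma0_zeroE: sS => oS.
  (* An open separator contains a cylinder around the full set, hence the finite set listed by
     [c.1]. Members of [H] avoiding its finitely many coordinates put its complement in both
     pullbacks. *)
  have [|c [c1 c2] cS] := open_cylinder oS (A := setT).
    by apply: FS; split; exists setT => //; exact: filterT.
  have SE : S [set z | z \in c.1].
    by apply: cS; split=> // z /c2; case.
  apply: (S0 _ SE); split.
    exists [set x | x \notin [seq z.1 | z <- c.1]]; first exact: has_rank_free rH.
    by move=> z /= /negP nz zc; apply: nz; exact: map_f.
  exists [set x | x \notin [seq z.2 | z <- c.1]]; first exact: has_rank_free rH.
  by move=> z /= /negP nz zc; apply: nz; exact: map_f.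
Qed.

Theorem theorem4p5 (alpha beta : omega1) (alpha_gt0 : ord_zero < alpha) :
  exists (I X : countType) (F : set_system I) (G : I -> set_system X),
    [/\ has_rank F beta,
        forall i, has_rank (G i) alpha &
        has_rank (filter_lim F G) ord_one].
Proof.
have [F rF] := has_rank_exists beta.
have [H rH] := has_rank_exists alpha.
pose G (i : bool * nat) :=
  if i.1 then pullback (@fst nat nat) H else pullback (@snd nat nat) H.
exists (bool * nat)%type, (nat * nat)%type, (pullback (@snd bool nat) F), G.
split.
- exact: (@has_rank_pullback _ _ _ (fun n => (true, n))).
- case=> -[] n; rewrite /G /=.
    exact: (@has_rank_pullback _ _ _ (fun n => (n, 0%N))).
  exact: (@has_rank_pullback _ _ _ (fun n => (0%N, n))).
(* A member of the pullback of [F] contains both [(true, n)] and [(false, n)] for some [n], which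
   forces membership in both filters. *)
- suff -> : filter_lim (pullback (@snd bool nat) F) G =
      pullback (@fst nat nat) H `&` pullback (@snd nat nat) H.
    exact: has_rank_pullbackI rH.
  have [[PF _] _ _] := rF.
  apply/seteqP; split=> [A [C /filter_ex[n Cn] CG]|A [A1 A2]].
    by split; [exact: (CG (true, n))|exact: (CG (false, n))].
  by exists setT; [exact: filterT|case=> -[]].
Qed.
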